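(* Let $N\in\mathbb{N}$ and let $\lambda_N(r,s)=\sum_{k=0}^{N}\alpha_k(r)(s-r)^k$. Let $u_0(r,t)=e^{it}$ and, for $n\ge 0$, define $$u_{n+1}(r,t)=u_n(r,t)+\int_{0}^{r}\lambda_N(r,s)\left(\frac{\partial^2 u_{n}}{\partial s^2}(s,t)-\frac{\partial^2 u_{n}}{\partial t^2}(s,t)+s\,u_{n}(s,t)\right)ds .$$ Then for every $R>0$ the sequence $(u_n)$ converges uniformly on $[-R,R]\times\mathbb{R}$ to $$u(r,t)=e^{it}\sum_{k=0}^{\infty}a_k r^k ,$$ the solution of the Klein-Gordon problem $u_{rr}-u_{tt}+ru=0$, $u(0,t)=e^{it}$, $u_r(0,t)=0$.
   Context: Here $\mathbb{N}=\{1,2,3,\dots\}$. The Klein-Gordon problem is $$u_{rr}-u_{tt}+ru=0\quad (r>0,\ -\infty<t<\infty),\qquad u(0,t)=e^{it},\qquad u_r(0,t)=0,$$ and its unique solution is $u(r,t)=e^{it}\sum_{k=0}^\infty a_kr^k$, where the real numbers $a_k$ (the Airy coefficients) are defined by $a_0=1$, $a_1=0$, $a_2=-\tfrac12$ and $$a_k=-\frac{a_{k-3}+a_{k-2}}{k(k-1)},\qquad k\ge 3 .$$ The functions $\alpha_k=\alpha_k(r)$ (polynomials in $r$) are defined by $\alpha_0=0$, $\alpha_1=1$, $\alpha_2=0$ and $$\alpha_k=-\frac{\alpha_{k-3}+r\,\alpha_{k-2}}{k(k-1)},\qquad k\ge 3 .$$ *)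

(* Defs.v *)
(* Stdlib reals with Coquelicot.  Complex-valued functions of a real variable
   are maps into Coquelicot's [C], viewed as a normed module over [R]. *)
From Stdlib Require Export Reals.
From Coquelicot Require Export Coquelicot.
Open Scope R_scope.

Fixpoint airy (k : nat) : R :=
  match k with
  | O => 1
  | S O => 0
  | S (S O) => - (1 / 2)
  | S (S (S m as m1)) => - (airy m + airy m1) / (INR k * (INR k - 1))
  end.

Fixpoint alpha (k : nat) (r : R) : R :=
  match k with
  | O => 0
  | S O => 1
  | S (S O) => 0
  | S (S (S m as m1)) =>
      - (alpha m r + r * alpha m1 r) / (INR k * (INR k - 1))
  end.

(* [sum_f_R0 f N] has N + 1 terms, k = 0, ..., N. *)
Definition lambda (N : nat) (r s : R) : R :=
  sum_f_R0 (fun k => alpha k r * (s - r) ^ k) N.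

Definition expi (t : R) : C := (cos t, sin t).

(* n-th derivative of a complex-valued function of a real variable; like
   [Derive_n] it is total, and meaningful only under [ex_CDerive_n]. *)
Definition CDerive_n (f : R -> C) (n : nat) (x : R) : C :=
  (Derive_n (fun y => Re (f y)) n x, Derive_n (fun y => Im (f y)) n x).

Definition ex_CDerive_n (f : R -> C) (n : nat) (x : R) : Prop :=
  ex_derive_n (fun y => Re (f y)) n x /\ ex_derive_n (fun y => Im (f y)) n x.

Definition KG_operator (u : R -> R -> C) (s t : R) : C :=
  (CDerive_n (fun x => u x t) 2 s - CDerive_n (fun y => u s y) 2 t
   + RtoC s * u s t)%C.

Definition correction (N : nat) (u : R -> R -> C) (r t s : R) : C :=
  (RtoC (lambda N r s) * KG_operator u s t)%C.

Fixpoint iterate (N n : nat) (r t : R) : C :=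
  match n with
  | O => expi t
  | S m =>
      (iterate N m r t
       + RInt (V := C_R_CompleteNormedModule)
           (correction N (iterate N m) r t) 0 r)%C
  end.

(* The derivatives and the integral in the step from u to its successor all
   exist, so that the total operators above do not return default values. *)
Definition step_well_defined (N : nat) (u : R -> R -> C) : Prop :=
  forall r t : R,
    (forall k : nat, (k <= 2)%nat ->
       ex_CDerive_n (fun x => u x t) k r /\ ex_CDerive_n (fun y => u r y) k t)
    /\ ex_RInt (V := C_R_NormedModule) (correction N u r t) 0 r.

Definition airy_wave (r t : R) : C := (expi t * RtoC (PSeries airy r))%C.

Definition cvg_uniformly_on (D : R -> R -> Prop)
    (u : nat -> R -> R -> C) (v : R -> R -> C) : Prop :=
  forall eps : R, 0 < eps ->
    exists n0 : nat, forall n : nat, (n0 <= n)%nat ->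
      forall r t : R, D r t -> Cmod (u n r t - v r t)%C < eps.

(* Derivative relative to [0, +oo[: the ordinary one at x > 0 and the
   right-hand one at x = 0. *)
Definition is_derive_half (f : R -> C) (x : R) (l : C) : Prop :=
  filterdiff (K := R_AbsRing) (U := R_NormedModule) (V := C_R_NormedModule)
    f (within (fun y => 0 <= y) (locally x))
    (fun h => scal (V := C_R_NormedModule) h l).

Definition is_derive_C (f : R -> C) (x : R) (l : C) : Prop :=
  is_derive (K := R_AbsRing) (V := C_R_NormedModule) f x l.

Definition continuous_on_C (D : R -> Prop) (f : R -> R -> C) : Prop :=
  continuous_on (T := prod_UniformSpace R_UniformSpace R_UniformSpace)
    (U := C_UniformSpace)
    (fun p => D (fst p)) (fun p => f (fst p) (snd p)).

(* Classical solution of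
     u_rr - u_tt + r u = 0 (r > 0),  u(0,t) = e^{it},  u_r(0,t) = 0 :
   of class C^2 for r > 0 and C^1 up to the boundary r = 0.  The values of u
   at r < 0 are irrelevant. *)
Definition KG_solution (u : R -> R -> C) : Prop :=
  exists ur ut urr urt utr utt : R -> R -> C,
    (forall r t : R, 0 <= r ->
       is_derive_half (fun x => u x t) r (ur r t) /\
       is_derive_C (fun y => u r y) t (ut r t)) /\
    (forall r t : R, 0 < r ->
       is_derive_C (fun x => ur x t) r (urr r t) /\
       is_derive_C (fun y => ur r y) t (urt r t) /\
       is_derive_C (fun x => ut x t) r (utr r t) /\
       is_derive_C (fun y => ut r y) t (utt r t)) /\
    continuous_on_C (fun r => 0 <= r) ur /\
    continuous_on_C (fun r => 0 <= r) ut /\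
    continuous_on_C (fun r => 0 < r) urr /\
    continuous_on_C (fun r => 0 < r) urt /\
    continuous_on_C (fun r => 0 < r) utr /\
    continuous_on_C (fun r => 0 < r) utt /\
    (forall r t : R, 0 < r ->
       (urr r t - utt r t + RtoC r * u r t)%C = RtoC 0) /\
    (forall t : R, u 0 t = expi t) /\
    (forall t : R, ur 0 t = RtoC 0).

(* Main.v *)
Require Import Defs.
From Stdlib Require Import Arith Lra Lia ClassicalEpsilon.

(** Every iterate has the form u_n = e^(it) p_n(r) with p_n smooth, p_n(0) = 1 and
    p_n'(0) = 0.  Let f = sum a_k r^k, so that f'' + (1 + r) f = 0, and e_n = p_n - f.
    Since lambda(r,r) = 0, lambda_s(r,r) = 1 and e_n(0) = e_n'(0) = 0, integrating
    by parts twice turns the iteration into the Volterra recursion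
      e_(n+1)(r) = int_0^r (lambda_ss(r,s) + (1 + s) lambda(r,s)) e_n(s) ds,
    which halves the norm sup |e(r)| exp(-L |r|) once L is twice a bound of the kernel.
    Only alpha_0 = 0 and alpha_1 = 1 matter, whence any N >= 1 works.

    For uniqueness, let w be a real solution with zero Cauchy data.  Along the
    characteristics t + r = const and t - r = const the functions w_r + w_t and
    w_r - w_t have derivative - r w.  On a backward triangle, integrating this
    and then w_r halves the bound B in |w| <= B exp(L r) for L large, so w = 0. *)

(** * Smooth functions and separable kernels *)

(** A chain of n witnessed derivatives, rather than a statement about [Derive_n]: closure under
    sums, products and reflection then follows by induction on n with f general, without formulas
    for higher derivatives. *)
Fixpoint diff_times (n : nat) (f : R -> R) : Prop :=
  match n with
  | O => True
  | S m => exists f', (forall x, is_derive f x (f' x)) /\ diff_times m f'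
  end.

Definition smooth (f : R -> R) : Prop := forall n, diff_times n f.

Lemma diff_times_pred n : forall f, diff_times (S n) f -> diff_times n f.
Proof.
  induction n as [|n IH]; intros f [f' [Hf Hf']]; [exact I|].
  exists f'. auto.
Qed.

Lemma diff_times_ext n f g :
  (forall x, f x = g x) -> diff_times n f -> diff_times n g.
Proof.
  destruct n; intros E H; [exact I|].
  destruct H as [f' [Hf Hf']]. exists f'. split; auto.
  intros x. apply (is_derive_ext f); auto.
Qed.

Lemma diff_times_plus n : forall f g,
  diff_times n f -> diff_times n g -> diff_times n (fun x => f x + g x).
Proof.
  induction n as [|n IH]; intros f g Hf Hg; [exact I|].
  destruct Hf as [f' [Hf Hf']], Hg as [g' [Hg Hg']].
  exists (fun x => f' x + g' x). split; auto.
  intros x. apply (is_derive_plus f g); auto.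
Qed.

Lemma diff_times_mult n : forall f g,
  diff_times n f -> diff_times n g -> diff_times n (fun x => f x * g x).
Proof.
  induction n as [|n IH]; intros f g Hf Hg; [exact I|].
  (* The derivative f' g + f g' contains f and g again, so they too must be n times
     differentiable. *)
  pose proof (diff_times_pred _ _ Hf). pose proof (diff_times_pred _ _ Hg).
  destruct Hf as [f' [Hf Hf']], Hg as [g' [Hg Hg']].
  exists (fun x => f' x * g x + f x * g' x). split.
  - intros x. apply (is_derive_mult f g); auto. intros; apply Rmult_comm.
  - apply diff_times_plus; auto.
Qed.

Lemma diff_times_const n : forall c, diff_times n (fun _ => c).
Proof.
  induction n as [|n IH]; intros c; [exact I|].
  exists (fun _ => 0). split; auto.
  intros x. apply (is_derive_const c).
Qed.

Lemma smooth_ext f g : (forall x, f x = g x) -> smooth f -> smooth g.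
Proof. intros E H n. apply (diff_times_ext n f); auto. Qed.

Lemma smooth_const c : smooth (fun _ => c).
Proof. intros n. apply diff_times_const. Qed.

Lemma smooth_id : smooth (fun x => x).
Proof.
  intros [|n]; [exact I|].
  exists (fun _ => 1). split; [|apply diff_times_const].
  intros x. apply (is_derive_id x).
Qed.

Lemma smooth_plus f g : smooth f -> smooth g -> smooth (fun x => f x + g x).
Proof. intros Hf Hg n. apply diff_times_plus; auto. Qed.

Lemma smooth_mult f g : smooth f -> smooth g -> smooth (fun x => f x * g x).
Proof. intros Hf Hg n. apply diff_times_mult; auto. Qed.

Lemma smooth_comp_opp f : smooth f -> smooth (fun x => f (- x)).
Proof.
  intros H n. specialize (H n). revert f H.
  induction n as [|n IH]; intros f H; [exact I|].
  destruct H as [f' [Hf Hf']]. exists (fun x => -1 * f' (- x)). split.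
  - intros x. apply (is_derive_comp f (fun s => - s)); [apply Hf|].
    auto_derive; auto.
  - apply (diff_times_mult n (fun _ => -1)); [apply diff_times_const|].
    now apply IH.
Qed.

Lemma smooth_is_derive f x : smooth f -> is_derive f x (Derive f x).
Proof.
  intros H. destruct (H 1%nat) as [f' [Hf _]].
  rewrite (is_derive_unique _ _ _ (Hf x)). apply Hf.
Qed.

Lemma smooth_Derive f : smooth f -> smooth (Derive f).
Proof.
  intros H n. destruct (H (S n)) as [f' [Hf Hf']].
  apply (diff_times_ext n f'); auto.
  intros x. symmetry. apply is_derive_unique, Hf.
Qed.

Lemma smooth_continuous f x : smooth f -> continuous f x.
Proof.
  intros H. apply (ex_derive_continuous f). exists (Derive f x).
  apply smooth_is_derive, H.
Qed.

Lemma smooth_ex_RInt f a b : smooth f -> ex_RInt f a b.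
Proof.
  intros H. apply (ex_RInt_continuous (V := R_CompleteNormedModule)).
  intros. apply smooth_continuous, H.
Qed.

Lemma is_derive_primitive f x :
  smooth f -> is_derive (fun r => RInt f 0 r) x (f x).
Proof.
  intros H. apply (is_derive_RInt f (fun r => RInt f 0 r) 0 x).
  - apply filter_forall. intros b. apply (RInt_correct (V := R_CompleteNormedModule)), smooth_ex_RInt, H.
  - apply smooth_continuous, H.
Qed.

Lemma smooth_primitive f : smooth f -> smooth (fun r => RInt f 0 r).
Proof.
  intros H [|n]; [exact I|].
  exists f. split; auto. intros x. apply is_derive_primitive, H.
Qed.

(* The class contains lambda and is stable under d/ds, while integration over
   [0, r] maps it to smooth functions of r. *)
Inductive separable : (R -> R -> R) -> Prop :=
| separable_prod c d : smooth c -> smooth d -> separable (fun r s => c r * d s)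
| separable_plus K L : separable K -> separable L ->
    separable (fun r s => K r s + L r s)
| separable_ext K L : (forall r s, K r s = L r s) -> separable K -> separable L.

Lemma separable_mult_prod K c d : smooth c -> smooth d -> separable K ->
  separable (fun r s => c r * d s * K r s).
Proof.
  intros Hc Hd HK. induction HK as [c' d' Hc' Hd' | K L HK IHK HL IHL | K L E HK IHK].
  - apply (separable_ext (fun r s => (c r * c' r) * (d s * d' s))).
    { intros; ring. }
    apply (separable_prod (fun r => c r * c' r) (fun s => d s * d' s));
      apply smooth_mult; auto.
  - eapply separable_ext; [|apply (separable_plus _ _ IHK IHL)].
    intros; simpl; ring.
  - eapply separable_ext; [|exact IHK]. intros; simpl. now rewrite E.
Qed.

Lemma separable_left c : smooth c -> separable (fun r _ => c r).
Proof.
  intros Hc. apply (separable_ext (fun r s => c r * 1)); [intros; ring|].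
  apply (separable_prod c (fun _ => 1)); auto using smooth_const.
Qed.

Lemma separable_mult_left K c : smooth c -> separable K ->
  separable (fun r s => c r * K r s).
Proof.
  intros Hc HK. apply (separable_ext (fun r s => c r * 1 * K r s)); [intros; ring|].
  apply (separable_mult_prod K c (fun _ => 1)); auto using smooth_const.
Qed.

Lemma separable_mult_right K d : smooth d -> separable K ->
  separable (fun r s => d s * K r s).
Proof.
  intros Hc HK. apply (separable_ext (fun r s => 1 * d s * K r s)); [intros; ring|].
  apply (separable_mult_prod K (fun _ => 1) d); auto using smooth_const.
Qed.

Lemma separable_smooth K r : separable K -> smooth (K r).
Proof.
  induction 1 as [c d Hc Hd | K L HK IHK HL IHL | K L E HK IHK].
  - apply smooth_mult; auto using smooth_const.
  - apply smooth_plus; auto.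
  - apply (smooth_ext (K r)); auto.
Qed.

Lemma separable_Derive K : separable K -> separable (fun r => Derive (K r)).
Proof.
  induction 1 as [c d Hc Hd | K L HK IHK HL IHL | K L E HK IHK].
  - apply (separable_ext (fun r s => c r * Derive d s)).
    { intros. symmetry. apply Derive_scal. }
    apply separable_prod; auto using smooth_Derive.
  - eapply separable_ext; [|apply (separable_plus _ _ IHK IHL)].
    intros r s. symmetry. apply (is_derive_unique (fun s => K r s + L r s)).
    apply (is_derive_plus (K r) (L r)); apply smooth_is_derive, separable_smooth; auto.
  - eapply separable_ext; [|exact IHK]. intros; simpl.
    apply Derive_ext. auto.
Qed.

(** In a product c(r) d(s) the factor c(r) leaves the integral and a primitive of d remains, so no
    differentiation under the integral sign is required. *)
Lemma separable_RInt K : separable K -> smooth (fun r => RInt (K r) 0 r).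
Proof.
  induction 1 as [c d Hc Hd | K L HK IHK HL IHL | K L E HK IHK].
  - apply (smooth_ext (fun r => c r * RInt d 0 r)).
    { intros. symmetry. apply (RInt_scal (V := R_CompleteNormedModule) d).
      apply smooth_ex_RInt, Hd. }
    apply smooth_mult; auto using smooth_primitive.
  - apply (smooth_ext (fun r => RInt (K r) 0 r + RInt (L r) 0 r)).
    { intros. symmetry. apply (RInt_plus (V := R_CompleteNormedModule) (K x) (L x));
      apply smooth_ex_RInt, separable_smooth; auto. }
    apply smooth_plus; auto.
  - eapply smooth_ext; [|exact IHK]. intros; simpl.
    apply RInt_ext. auto.
Qed.

(** Leibniz rule at r = 0: the term with the differentiated kernel is an integral over a degenerate
    interval, and only the boundary value survives. *)
Lemma Derive_separable_RInt_0 K :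
  separable K -> Derive (fun r => RInt (K r) 0 r) 0 = K 0 0.
Proof.
  induction 1 as [c d Hc Hd | K L HK IHK HL IHL | K L E HK IHK].
  - apply is_derive_unique.
    apply (is_derive_ext (fun r => c r * RInt d 0 r)).
    { intros. symmetry. apply (RInt_scal (V := R_CompleteNormedModule) d).
      apply smooth_ex_RInt, Hd. }
    replace (c 0 * d 0) with (Derive c 0 * RInt d 0 0 + c 0 * d 0).
    + apply (is_derive_mult c (fun r => RInt d 0 r)).
      * apply smooth_is_derive, Hc.
      * apply is_derive_primitive, Hd.
      * intros; apply Rmult_comm.
    + rewrite RInt_point. change zero with 0. ring.
  - rewrite (Derive_ext _ (fun r => RInt (K r) 0 r + RInt (L r) 0 r)).
    { rewrite Derive_plus, IHK, IHL; auto;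
        eexists; apply smooth_is_derive, separable_RInt; auto. }
    intros. apply (RInt_plus (V := R_CompleteNormedModule) (K t) (L t));
      apply smooth_ex_RInt, separable_smooth; auto.
  - rewrite <- E, <- IHK. apply Derive_ext. intros. apply RInt_ext. auto.
Qed.

Lemma smooth_bounded f rho : smooth f ->
  exists M, forall x, Rabs x <= rho -> Rabs (f x) <= M.
Proof.
  intros H. destruct (Rle_dec 0 rho) as [Hr|Hr].
  2: { exists 0. intros x Hx. pose proof (Rabs_pos x). lra. }
  destruct (continuity_ab_maj (fun x => Rabs (f x)) (- rho) rho) as [z [Hz _]]; [lra| |].
  - intros c _. apply (continuity_pt_comp f Rabs).
    + apply continuity_pt_filterlim, smooth_continuous, H.
    + apply Rcontinuity_abs.
  - exists (Rabs (f z)). intros x Hx. apply Hz. apply Rabs_le_between in Hx. lra.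
Qed.

Lemma separable_bounded K rho : separable K ->
  exists M, 0 < M /\
    forall r s, Rabs r <= rho -> Rabs s <= rho -> Rabs (K r s) <= M.
Proof.
  induction 1 as [c d Hc Hd | K L HK [M [HM IHK]] HL [M' [HM' IHL]] | K L E HK [M [HM IHK]]].
  - destruct (smooth_bounded c rho Hc) as [A HA].
    destruct (smooth_bounded d rho Hd) as [B HB].
    (* The summand 1 keeps the bound positive even when A or B is 0; the exponent L = 2 M chosen
       later must be positive. *)
    exists (Rabs A * Rabs B + 1). split.
    { pose proof (Rabs_pos A). pose proof (Rabs_pos B). nra. }
    intros r s Hr Hs. rewrite Rabs_mult.
    specialize (HA r Hr). specialize (HB s Hs).
    pose proof (Rle_abs A). pose proof (Rle_abs B).
    pose proof (Rabs_pos (c r)). pose proof (Rabs_pos (d s)).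
    assert (Rabs (c r) * Rabs (d s) <= Rabs A * Rabs B) by (apply Rmult_le_compat; lra).
    lra.
  - exists (M + M'). split; [lra|]. intros r s Hr Hs.
    eapply Rle_trans; [apply Rabs_triang|].
    apply Rplus_le_compat; auto.
  - exists M. split; auto. intros. rewrite <- E. auto.
Qed.

(** * The kernel lambda: separability and values on the diagonal *)

Lemma smooth_alpha k : smooth (alpha k).
Proof.
  induction k as [k IH] using (well_founded_induction lt_wf).
  destruct k as [|[|[|m]]].
  - apply (smooth_const 0).
  - apply (smooth_const 1).
  - apply (smooth_const 0).
  - set (c := / (INR (S (S (S m))) * (INR (S (S (S m))) - 1))).
    apply (smooth_ext (fun r => (- c) * (alpha m r + r * alpha (S m) r))).
    { intros x. unfold c. cbn [alpha]. unfold Rdiv. ring. }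
    apply (smooth_mult (fun _ => - c)); [apply smooth_const|].
    apply smooth_plus; [apply IH; lia|].
    apply (smooth_mult (fun x => x)); [apply smooth_id|apply IH; lia].
Qed.

(** Induction through (s - r)^(k+1) = s (s - r)^k - r (s - r)^k replaces the binomial expansion. *)
Lemma separable_pow_diff k : separable (fun r s => (s - r) ^ k).
Proof.
  induction k as [|k IH].
  - apply (separable_left (fun _ => 1)), smooth_const.
  - apply (separable_ext (fun r s => s * (s - r) ^ k + (- 1 * r) * (s - r) ^ k)).
    { intros; simpl; ring. }
    apply separable_plus.
    + apply (separable_mult_right (fun r s => (s - r) ^ k) (fun s => s));
        auto using smooth_id.
    + apply (separable_mult_left (fun r s => (s - r) ^ k) (fun r => -1 * r)); auto.
      apply (smooth_mult (fun _ => -1) (fun r => r)); auto using smooth_id, smooth_const.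
Qed.

Lemma separable_lambda N : separable (lambda N).
Proof.
  unfold lambda.
  assert (T : forall k, separable (fun r s => alpha k r * (s - r) ^ k)).
  { intros k. apply (separable_mult_left (fun r s => (s - r) ^ k)).
    - apply smooth_alpha.
    - apply separable_pow_diff. }
  induction N as [|N IH]; [apply (T O)|].
  apply (separable_plus _ _ IH (T (S N))).
Qed.

(** Every term with k >= 1 has the factor s - r, and the constant term vanishes because alpha_0 =
    0. *)
Lemma lambda_diag N r : lambda N r r = 0.
Proof.
  unfold lambda. induction N as [|N IH]; simpl; [ring|].
  rewrite IH. ring.
Qed.

(** The linear term contributes alpha_1 = 1, and terms with k >= 2 have at least a double zero at s
    = r. The linear term is present because N >= 1. *)
Lemma Derive_lambda_diag N r : (1 <= N)%nat -> Derive (lambda N r) r = 1.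
Proof.
  intros HN. apply is_derive_unique. unfold lambda.
  destruct N as [|N]; [lia|]. clear HN.
  induction N as [|N IH].
  - simpl. auto_derive; auto. ring.
  - cbn [sum_f_R0] in *.
    replace 1 with (1 + 0) by ring.
    apply (is_derive_plus (V := R_NormedModule) _ (fun s => alpha (S (S N)) r * (s - r) ^ S (S N)) r 1 0 IH).
    auto_derive; auto. simpl pred. replace (r + - r) with 0 by ring.
    rewrite Rmult_0_l. ring.
Qed.

(** * The Airy series *)

Lemma airy_SSS m :
  airy (S (S (S m))) =
  - (airy m + airy (S m)) / (INR (S (S (S m))) * (INR (S (S (S m))) - 1)).
Proof. reflexivity. Qed.

(* Once n (n - 1) >= |x|^3 + |x|^2, the recursion bounds |a_n x^n| by the maximum
   of two earlier terms. *)
Lemma airy_terms_bounded x : exists M, forall n, Rabs (airy n * x ^ n) <= M.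
Proof.
  set (y := Rabs x). set (q := y ^ 3 + y ^ 2).
  assert (Hy : 0 <= y) by apply Rabs_pos.
  assert (Hq : 0 <= q) by (unfold q; pose proof (pow_le y 3 Hy); pose proof (pow_le y 2 Hy); lra).
  destruct (nfloor_ex q Hq) as [K [_ HK]].
  set (b := fun n => Rabs (airy n * x ^ n)).
  assert (Hb : forall n, 0 <= b n) by (intros; apply Rabs_pos).
  (* A sum of nonnegative terms dominates each of them, so M bounds the terms up to K + 3; later
     terms are handled by the recursion. *)
  set (M := sum_f_R0 b (K + 3)).
  exists M. intros n. fold (b n).
  induction n as [n IH] using (well_founded_induction lt_wf).
  destruct (le_lt_dec n (K + 3)) as [Hn|Hn].
  - unfold M. clear -Hn Hb. induction (K + 3)%nat as [|j IHj].
    + replace n with O by lia. simpl. lra.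
    + rewrite tech5. destruct (Nat.eq_dec n (S j)) as [->|Hne].
      * pose proof (cond_pos_sum b j Hb). lra.
      * assert (Hn' : (n <= j)%nat) by lia.
        specialize (IHj Hn'). pose proof (Hb (S j)). lra.
  - destruct n as [|[|[|m]]]; try lia.
    (* Here m >= K + 1 > q, hence the denominator d = (m + 3)(m + 2) exceeds q. *)
    set (d := INR (S (S (S m))) * (INR (S (S (S m))) - 1)).
    assert (Hd : q <= d /\ 0 < d).
    { assert (HM : (K + 1 <= m)%nat) by lia. apply le_INR in HM.
      rewrite plus_INR in HM. simpl (INR 1) in HM.
      pose proof (pos_INR K). unfold d. rewrite !S_INR. split; nra. }
    assert (E : airy (S (S (S m))) * x ^ S (S (S m)) =
                - (x ^ 3 * (airy m * x ^ m) + x ^ 2 * (airy (S m) * x ^ S m)) / d).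
    { rewrite airy_SSS. fold d. simpl pow. field. lra. }
    unfold b. rewrite E. unfold Rdiv. rewrite Rabs_mult, Rabs_Ropp, Rabs_inv.
    rewrite (Rabs_pos_eq d) by lra.
    apply (Rmult_le_reg_r d); [lra|].
    rewrite Rmult_assoc, Rinv_l, Rmult_1_r by lra.
    eapply Rle_trans; [apply Rabs_triang|].
    rewrite !(Rabs_mult (x ^ _)), <- !RPow_abs. fold y (b m) (b (S m)).
    assert (Hm : b m <= M) by (apply IH; lia).
    assert (Hm' : b (S m) <= M) by (apply IH; lia).
    pose proof (Hb m). pose proof (pow_le y 3 Hy). pose proof (pow_le y 2 Hy).
    assert (y ^ 3 * b m <= y ^ 3 * M) by (apply Rmult_le_compat_l; lra).
    assert (y ^ 2 * b (S m) <= y ^ 2 * M) by (apply Rmult_le_compat_l; lra).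
    assert (q * M <= d * M) by (apply Rmult_le_compat_r; lra).
    unfold q in *. lra.
Qed.

(** The radius is the least upper bound of the points where the terms stay bounded, and they stay
    bounded everywhere. *)
Lemma CV_radius_airy : CV_radius airy = p_infty.
Proof.
  destruct (CV_radius_bounded airy) as [H _].
  destruct (CV_radius airy) as [c| |]; auto; exfalso.
  - specialize (H (c + 1) (airy_terms_bounded (c + 1))). simpl in H. lra.
  - apply (H 0 (airy_terms_bounded 0)).
Qed.

Lemma ex_pseries_CV_infinite a x : CV_radius a = p_infty -> ex_pseries a x.
Proof. intros H. apply CV_radius_inside. rewrite H. exact I. Qed.

Lemma is_derive_entire a x :
  CV_radius a = p_infty -> is_derive (PSeries a) x (PSeries (PS_derive a) x).
Proof. intros H. apply is_derive_PSeries. rewrite H. exact I. Qed.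

Lemma smooth_entire a : CV_radius a = p_infty -> smooth (PSeries a).
Proof.
  intros H n. revert a H. induction n as [|n IH]; intros a H; [exact I|].
  exists (PSeries (PS_derive a)). split.
  - intros x. apply is_derive_entire, H.
  - apply IH. now rewrite CV_radius_derive.
Qed.

Definition Airy : R -> R := PSeries airy.

Lemma smooth_Airy : smooth Airy.
Proof. apply smooth_entire, CV_radius_airy. Qed.

Lemma Airy_0 : Airy 0 = 1.
Proof. apply PSeries_0. Qed.

Lemma Derive_Airy x : Derive Airy x = PSeries (PS_derive airy) x.
Proof. apply is_derive_unique, is_derive_entire, CV_radius_airy. Qed.

Lemma Derive_Airy_0 : Derive Airy 0 = 0.
Proof. rewrite Derive_Airy, PSeries_0. unfold PS_derive. simpl. ring. Qed.

(** Comparison of coefficients: that of x^m is (m+2)(m+1) a_(m+2) + a_m + a_(m-1), zero by the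
    recursion. The case m = 0 has no a_(m-1) and rests on a_2 = -1/2. *)
Lemma Airy_ode x : Derive (Derive Airy) x + Airy x + x * Airy x = 0.
Proof.
  assert (Hr : CV_radius (PS_derive airy) = p_infty).
  { rewrite CV_radius_derive. apply CV_radius_airy. }
  rewrite (Derive_ext _ _ x Derive_Airy).
  rewrite (is_derive_unique _ _ _ (is_derive_entire _ x Hr)).
  unfold Airy. rewrite <- PSeries_incr_1.
  assert (Ha : ex_pseries airy x) by apply ex_pseries_CV_infinite, CV_radius_airy.
  assert (Hi : ex_pseries (PS_incr_1 airy) x) by now apply ex_pseries_incr_1.
  assert (H2 : ex_pseries (PS_derive (PS_derive airy)) x).
  { apply ex_pseries_CV_infinite. now rewrite CV_radius_derive. }
  rewrite <- PSeries_plus, <- PSeries_plus; auto.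
  2: now apply ex_pseries_plus.
  rewrite (PSeries_ext _ (fun _ => 0)); [apply PSeries_const_0|].
  intros [|m]; unfold PS_plus, PS_derive, PS_incr_1.
  - change plus with Rplus. simpl. change zero with 0. lra.
  - change plus with Rplus. rewrite airy_SSS, !S_INR.
    pose proof (pos_INR m). field. lra.
Qed.

(** * Convergence of the iteration *)

(** The radial factor that the Klein-Gordon operator produces from e^(it) p; the middle term comes
    from - u_tt. *)
Definition residual (p : R -> R) (s : R) : R :=
  Derive (Derive p) s + p s + s * p s.

(** The radial factor p_n of the iterate, computed over the reals; [iterate_profile] makes the
    link. *)
Fixpoint profile (N n : nat) : R -> R :=
  match n with
  | O => fun _ => 1
  | S m => fun r =>
      profile N m r + RInt (fun s => lambda N r s * residual (profile N m) s) 0 r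
  end.

Lemma smooth_residual p : smooth p -> smooth (residual p).
Proof.
  intros H. unfold residual. apply smooth_plus.
  - apply smooth_plus; auto using smooth_Derive.
  - apply (smooth_mult (fun s => s)); auto using smooth_id.
Qed.

Lemma separable_lambda_residual N p : smooth p ->
  separable (fun r s => lambda N r s * residual p s).
Proof.
  intros H. apply (separable_ext (fun r s => residual p s * lambda N r s)).
  { intros. apply Rmult_comm. }
  apply separable_mult_right; auto using smooth_residual, separable_lambda.
Qed.

Lemma smooth_profile N n : smooth (profile N n).
Proof.
  induction n as [|n IH]; [apply (smooth_const 1)|].
  cbn [profile]. apply smooth_plus; auto.
  apply separable_RInt, separable_lambda_residual, IH.
Qed.

Lemma profile_0 N n : profile N n 0 = 1.
Proof.
  induction n as [|n IH]; [reflexivity|].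
  cbn [profile]. rewrite IH, RInt_point. change zero with 0. ring.
Qed.

(** The increment has derivative lambda(0,0) times the residual at 0, and lambda vanishes on the
    diagonal. *)
Lemma Derive_profile_0 N n : Derive (profile N n) 0 = 0.
Proof.
  induction n as [|n IH]; [exact (Derive_const 1 0)|].
  cbn [profile].
  assert (HK := separable_lambda_residual N _ (smooth_profile N n)).
  rewrite Derive_plus, IH, Derive_separable_RInt_0; auto.
  - rewrite lambda_diag. ring.
  - eexists; apply smooth_is_derive, smooth_profile.
  - eexists. apply (smooth_is_derive (fun r => RInt (fun s => lambda N r s * residual (profile N n) s) 0 r)).
    apply (separable_RInt _ HK).
Qed.

(** The formally self-adjoint operator d^2/ds^2 + 1 + s of [residual], moved onto lambda as a
    function of s. *)
Definition volterra_kernel (N : nat) (r s : R) : R :=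
  Derive (Derive (lambda N r)) s + (1 + s) * lambda N r s.

Lemma separable_volterra_kernel N : separable (volterra_kernel N).
Proof.
  apply separable_plus.
  - apply (separable_Derive (fun r => Derive (lambda N r))).
    apply separable_Derive, separable_lambda.
  - apply (separable_mult_right (lambda N) (fun s => 1 + s)).
    + apply (smooth_plus (fun _ => 1)); auto using smooth_const, smooth_id.
    + apply separable_lambda.
Qed.

(* Two integrations by parts; the boundary terms are lambda(r,r) = 0,
   lambda_s(r,r) = 1 and the Cauchy data of h. *)
Lemma step_eq_volterra N h r : (1 <= N)%nat ->
  smooth h -> h 0 = 0 -> Derive h 0 = 0 ->
  h r + RInt (fun s => lambda N r s * residual h s) 0 r =
  RInt (fun s => volterra_kernel N r s * h s) 0 r.
Proof.
  intros HN Hh H0 H0'.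
  assert (Hl : smooth (lambda N r)) by apply separable_smooth, separable_lambda.
  set (l := lambda N r) in *.
  assert (Hl1 := smooth_Derive _ Hl). assert (Hl2 := smooth_Derive _ Hl1).
  assert (Hh1 := smooth_Derive _ Hh). assert (Hh2 := smooth_Derive _ Hh1).
  (* Lagrange's identity: g = l h'' - l'' h is the derivative of l h' - l' h, which performs both
     integrations by parts at once. *)
  set (g := fun s => l s * Derive (Derive h) s + - 1 * (Derive (Derive l) s * h s)).
  assert (Hg : smooth g).
  { apply smooth_plus; [now apply smooth_mult|].
    apply (smooth_mult (fun _ => -1)); [apply smooth_const|now apply smooth_mult]. }
  assert (IG : is_RInt g 0 r (- h r)).
  { replace (- h r) with
      (minus (l r * Derive h r - Derive l r * h r) (l 0 * Derive h 0 - Derive l 0 * h 0)).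
    - apply (is_RInt_derive (V := R_CompleteNormedModule) (fun s => l s * Derive h s - Derive l s * h s)).
      + intros x _. unfold g.
        replace (l x * Derive (Derive h) x + - 1 * (Derive (Derive l) x * h x))
          with (Derive l x * Derive h x + l x * Derive (Derive h) x
                - (Derive (Derive l) x * h x + Derive l x * Derive h x)) by ring.
        apply (is_derive_minus (V := R_NormedModule) (fun s => l s * Derive h s) (fun s => Derive l s * h s)).
        * apply (is_derive_mult l (Derive h)); try (intros; apply Rmult_comm);
            apply smooth_is_derive; auto.
        * apply (is_derive_mult (Derive l) h); try (intros; apply Rmult_comm);
            apply smooth_is_derive; auto.
      + intros x _. apply smooth_continuous, Hg.
    - rewrite H0, H0'. unfold l. rewrite lambda_diag, Derive_lambda_diag by auto.
      change (0 * Derive h r - 1 * h r - (lambda N r 0 * 0 - Derive (lambda N r) 0 * 0) = - h r).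
      ring. }
  assert (HK : smooth (fun s => volterra_kernel N r s * h s)).
  { apply smooth_mult; auto. apply separable_smooth, separable_volterra_kernel. }
  rewrite (RInt_ext (fun s => l s * residual h s) (fun s => plus (g s) ((fun s => volterra_kernel N r s * h s) s))).
  2: { intros. change plus with Rplus. unfold g, residual, volterra_kernel. fold l. simpl. ring. }
  rewrite (RInt_plus (V := R_CompleteNormedModule) g (fun s => volterra_kernel N r s * h s));
    [|apply smooth_ex_RInt, Hg | apply smooth_ex_RInt, HK].
  rewrite (is_RInt_unique _ _ _ _ IG). change plus with Rplus. simpl. ring.
Qed.

(** The residual is linear and vanishes on [Airy], so p_n and h = p_n - Airy have the same residual.
    The step from p_n therefore acts on the error as the step from h, which has zero Cauchy data. *)
Lemma profile_error_step N n r : (1 <= N)%nat ->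
  profile N (S n) r - Airy r =
  RInt (fun s => volterra_kernel N r s * (profile N n s - Airy s)) 0 r.
Proof.
  intros HN. set (p := profile N n).
  assert (Hp : smooth p) by apply smooth_profile.
  assert (Hf := smooth_Airy).
  set (h := fun s => p s + - 1 * Airy s).
  assert (D1 : forall x, Derive h x = Derive p x + -1 * Derive Airy x).
  { intros x. unfold h. rewrite Derive_plus, Derive_scal; auto.
    - eexists; apply smooth_is_derive, Hp.
    - apply ex_derive_scal. eexists; apply smooth_is_derive, Hf. }
  assert (D2 : forall x, Derive (Derive h) x = Derive (Derive p) x + -1 * Derive (Derive Airy) x).
  { intros x. rewrite (Derive_ext _ _ x D1). rewrite Derive_plus, Derive_scal; auto.
    - eexists; apply smooth_is_derive, smooth_Derive, Hp.
    - apply ex_derive_scal. eexists; apply smooth_is_derive, smooth_Derive, Hf. }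
  rewrite (RInt_ext _ (fun s => volterra_kernel N r s * h s)).
  2: { intros. unfold h. simpl. ring. }
  rewrite <- step_eq_volterra; auto.
  - cbn [profile]. fold p. rewrite (RInt_ext _ (fun s => lambda N r s * residual h s)).
    + unfold h. simpl. ring.
    + intros s _. unfold residual. rewrite D2. unfold h.
      pose proof (Airy_ode s). f_equal. simpl in *. lra.
  - apply smooth_plus; auto. apply (smooth_mult (fun _ => -1)); auto using smooth_const.
  - unfold h, p. rewrite profile_0, Airy_0. ring.
  - rewrite D1. unfold p. rewrite Derive_profile_0, Derive_Airy_0. ring.
Qed.

(** Integrating exp(L s) gains a factor 1 / L, the source of the contraction. Negative r is reduced
    to positive r by the reflection s -> - s. *)
Lemma RInt_exp_bound g r B L : 0 < L -> smooth g ->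
  (forall s, Rabs s <= Rabs r -> Rabs (g s) <= B * exp (L * Rabs s)) ->
  0 <= B -> Rabs (RInt g 0 r) <= B / L * exp (L * Rabs r).
Proof.
  intros HL Hg HB HB0.
  assert (Pos : forall g x, 0 <= x -> smooth g ->
    (forall s, 0 <= s <= x -> Rabs (g s) <= B * exp (L * s)) ->
    Rabs (RInt g 0 x) <= B / L * exp (L * x)).
  { clear -HL HB0. intros g x Hx Hg HB.
    assert (IE : is_RInt (fun s => B * exp (L * s)) 0 x (B / L * exp (L * x) - B / L * exp (L * 0))).
    { apply (is_RInt_derive (V := R_CompleteNormedModule) (fun s => B / L * exp (L * s))).
      - intros s _. auto_derive; auto. field. lra.
      - intros s _. apply (ex_derive_continuous (fun s => B * exp (L * s))). auto_derive. auto. }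
    eapply Rle_trans; [apply abs_RInt_le; auto; apply smooth_ex_RInt, Hg|].
    apply Rle_trans with (RInt (fun s => B * exp (L * s)) 0 x).
    - apply RInt_le; auto.
      + apply (ex_RInt_continuous (V := R_CompleteNormedModule)). intros z _.
        apply (continuous_comp g Rabs); [apply smooth_continuous, Hg|].
        apply continuity_pt_filterlim, Rcontinuity_abs.
      + eexists; apply IE.
      + intros s Hs. apply HB. lra.
    - rewrite (is_RInt_unique _ _ _ _ IE).
      assert (0 <= B / L * exp (L * 0)); [|lra].
      apply Rmult_le_pos; [apply Rdiv_le_0_compat; lra|left; apply exp_pos]. }
  destruct (Rle_dec 0 r) as [Hr|Hr].
  - rewrite (Rabs_pos_eq r) by auto. apply Pos; auto.
    intros s Hs. rewrite <- (Rabs_pos_eq s) at 2 by lra. apply HB.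
    rewrite !Rabs_pos_eq; lra.
  - assert (Hr' : r < 0) by lra.
    assert (Hopp : smooth (fun s => g (- s))) by now apply smooth_comp_opp.
    assert (I : is_RInt g 0 r (- RInt (fun s => g (- s)) 0 (- r))).
    { apply (is_RInt_ext (fun s => opp (opp (g (- - s))))).
      { intros s _. rewrite opp_opp, Ropp_involutive. reflexivity. }
      apply (is_RInt_comp_opp (fun s => opp (g (- s)))).
      rewrite Ropp_0.
      apply (is_RInt_opp (fun s => g (- s))).
      apply (RInt_correct (V := R_CompleteNormedModule)), smooth_ex_RInt, Hopp. }
    rewrite (is_RInt_unique _ _ _ _ I), Rabs_Ropp.
    rewrite (Rabs_left r) by auto. apply Pos; auto; [lra|].
    intros s Hs. rewrite <- (Rabs_pos_eq s) at 2 by lra.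
    rewrite <- (Rabs_Ropp s). apply HB.
    rewrite Rabs_Ropp, (Rabs_pos_eq s), (Rabs_left r); lra.
Qed.

Lemma profile_error_bound N rho : (1 <= N)%nat -> 0 < rho ->
  exists C, 0 < C /\ forall n r, Rabs r <= rho ->
    Rabs (profile N n r - Airy r) <= C * (/ 2) ^ n.
Proof.
  intros HN Hrho.
  destruct (separable_bounded _ rho (separable_volterra_kernel N)) as [M [HM HK]].
  destruct (smooth_bounded Airy rho smooth_Airy) as [A HA].
  assert (HA0 : 0 <= A).
  { eapply Rle_trans; [apply Rabs_pos|apply (HA 0)]. rewrite Rabs_R0. lra. }
  (* B bounds the initial error 1 - Airy, and L = 2 M turns the gain M / L of each step into 1/2. *)
  set (B := 1 + A). set (L := 2 * M).
  assert (Hexp : forall x, 0 <= x -> 1 <= exp (L * x)).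
  { intros x Hx. rewrite <- exp_0. destruct (Rle_lt_or_eq_dec 0 x Hx) as [H|<-].
    - left. apply exp_increasing. unfold L. nra.
    - rewrite Rmult_0_r. lra. }
  assert (Main : forall n r, Rabs r <= rho ->
    Rabs (profile N n r - Airy r) <= B * (/ 2) ^ n * exp (L * Rabs r)).
  { induction n as [|n IH]; intros r Hr.
    - assert (Rabs (profile N 0 r - Airy r) <= B).
      { cbn [profile]. unfold Rminus. eapply Rle_trans; [apply Rabs_triang|].
        rewrite Rabs_R1, Rabs_Ropp. unfold B. specialize (HA r Hr). lra. }
      specialize (Hexp (Rabs r) (Rabs_pos r)). simpl pow. unfold B in *. nra.
    - rewrite profile_error_step by auto.
      replace (B * (/ 2) ^ S n * exp (L * Rabs r))
        with (M * (B * (/ 2) ^ n) / L * exp (L * Rabs r)).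
      2: { unfold L. simpl. field. lra. }
      assert (HB : 0 <= B * (/ 2) ^ n).
      { apply Rmult_le_pos; [unfold B; lra|apply pow_le; lra]. }
      apply RInt_exp_bound.
      + unfold L; lra.
      + apply smooth_mult.
        * apply separable_smooth, separable_volterra_kernel.
        * apply (smooth_ext (fun s => profile N n s + -1 * Airy s)); [intros; ring|].
          apply smooth_plus; [apply smooth_profile|].
          apply (smooth_mult (fun _ => -1)); auto using smooth_const, smooth_Airy.
      + intros s Hs. rewrite Rabs_mult, (Rmult_assoc M).
        apply Rmult_le_compat; try apply Rabs_pos.
        * apply HK; lra.
        * apply IH. lra.
      + apply Rmult_le_pos; lra. }
  exists (B * exp (L * rho)). split.
  { apply Rmult_lt_0_compat; [unfold B; lra|apply exp_pos]. }
  intros n r Hr. eapply Rle_trans; [apply Main, Hr|].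
  replace (B * exp (L * rho) * (/ 2) ^ n) with (B * (/ 2) ^ n * exp (L * rho)) by ring.
  apply Rmult_le_compat_l.
  - apply Rmult_le_pos; [unfold B; lra|apply pow_le; lra].
  - destruct (Req_dec (Rabs r) rho) as [->|Hne]; [lra|].
    left. apply exp_increasing. apply Rmult_lt_compat_l; unfold L; lra.
Qed.

(** * Separation of variables and the complex iterates *)

(** The family with coefficients a and b is closed under differentiation, so one induction treats
    sine and cosine together. *)
Lemma smooth_trig a b : smooth (fun x => a * cos x + b * sin x).
Proof.
  intros n. revert a b. induction n as [|n IH]; intros a b; [exact I|].
  exists (fun x => b * cos x + (- a) * sin x). split; [|apply IH].
  intros x. auto_derive; auto. ring.
Qed.

Lemma smooth_Derive_n f n : smooth f -> smooth (Derive_n f n).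
Proof. intros H. induction n; [exact H|]. apply smooth_Derive, IHn. Qed.

Lemma smooth_ex_derive_n f n x : smooth f -> ex_derive_n f n x.
Proof.
  intros H. destruct n; [exact I|]. eexists. apply smooth_is_derive, smooth_Derive_n, H.
Qed.

Lemma Derive_n_2_trig a b x :
  Derive_n (fun y => a * cos y + b * sin y) 2 x = - (a * cos x + b * sin x).
Proof.
  simpl. rewrite (Derive_ext _ (fun y => b * cos y - a * sin y)).
  - apply is_derive_unique. auto_derive; auto. ring.
  - intros y. apply is_derive_unique. auto_derive; auto. ring.
Qed.

Section SeparatedWave.

(** The function u is arbitrary and separated only pointwise, since an iterate is known to equal
    e^(it) p_n pointwise; no functional extensionality is involved. *)
Variables (u : R -> R -> C) (p : R -> R).
Hypothesis Hu : forall r t, u r t = (expi t * RtoC (p r))%C.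
Hypothesis Hp : smooth p.

Lemma Re_wave r t : Re (u r t) = cos t * p r.
Proof. rewrite Hu. unfold Re. simpl. ring. Qed.

Lemma Im_wave r t : Im (u r t) = sin t * p r.
Proof. rewrite Hu. unfold Im. simpl. ring. Qed.

Lemma ex_CDerive_n_wave k r t :
  ex_CDerive_n (fun x => u x t) k r /\ ex_CDerive_n (fun y => u r y) k t.
Proof.
  repeat split; apply smooth_ex_derive_n.
  - apply (smooth_ext (fun x => cos t * p x)); [intros; now rewrite Re_wave|].
    apply (smooth_mult (fun _ => cos t)); auto using smooth_const.
  - apply (smooth_ext (fun x => sin t * p x)); [intros; now rewrite Im_wave|].
    apply (smooth_mult (fun _ => sin t)); auto using smooth_const.
  - apply (smooth_ext (fun y => p r * cos y + 0 * sin y)), smooth_trig.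
    intros; rewrite Re_wave; ring.
  - apply (smooth_ext (fun y => 0 * cos y + p r * sin y)), smooth_trig.
    intros; rewrite Im_wave; ring.
Qed.

Lemma KG_operator_wave s t :
  KG_operator u s t = (expi t * RtoC (residual p s))%C.
Proof.
  unfold KG_operator, CDerive_n.
  rewrite (Derive_n_ext _ _ 2 s (fun x => Re_wave x t)), Derive_n_scal_l.
  rewrite (Derive_n_ext _ _ 2 s (fun x => Im_wave x t)), Derive_n_scal_l.
  rewrite (Derive_n_ext (fun y => Re (u s y)) (fun y => p s * cos y + 0 * sin y)),
    (Derive_n_ext (fun y => Im (u s y)) (fun y => 0 * cos y + p s * sin y)),
    !Derive_n_2_trig.
  - rewrite Hu. unfold residual.
    apply injective_projections; simpl;
      change (fun x => Derive (fun y => p y) x) with (Derive p); ring.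
  - intros; rewrite Im_wave; ring.
  - intros; rewrite Re_wave; ring.
Qed.

Lemma is_RInt_correction_wave N r t :
  is_RInt (V := C_R_NormedModule) (correction N u r t) 0 r
    (expi t * RtoC (RInt (fun s => lambda N r s * residual p s)%R 0 r))%C.
Proof.
  set (g := fun s => lambda N r s * residual p s).
  assert (Ig : is_RInt g 0 r (RInt g 0 r)).
  { apply (RInt_correct (V := R_CompleteNormedModule)), smooth_ex_RInt.
    apply (separable_smooth (fun r s => lambda N r s * residual p s)).
    now apply separable_lambda_residual. }
  replace (expi t * RtoC (RInt g 0 r))%C with (cos t * RInt g 0 r, sin t * RInt g 0 r).
  2: { apply injective_projections; simpl; ring. }
  apply (is_RInt_fct_extend_pair (U := R_NormedModule) (V := R_NormedModule)).
  - apply (is_RInt_ext (fun s => scal (cos t) (g s))).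
    { intros s _. unfold correction. rewrite KG_operator_wave.
      change scal with Rmult. unfold g. simpl. ring. }
    apply (is_RInt_scal g 0 r (cos t)), Ig.
  - apply (is_RInt_ext (fun s => scal (sin t) (g s))).
    { intros s _. unfold correction. rewrite KG_operator_wave.
      change scal with Rmult. unfold g. simpl. ring. }
    apply (is_RInt_scal g 0 r (sin t)), Ig.
Qed.

Lemma step_well_defined_wave N : step_well_defined N u.
Proof.
  intros r t. split.
  - intros k _. apply ex_CDerive_n_wave.
  - eexists. apply is_RInt_correction_wave.
Qed.

End SeparatedWave.

Lemma iterate_profile N n r t :
  iterate N n r t = (expi t * RtoC (profile N n r))%C.
Proof.
  revert r t. induction n as [|n IH]; intros r t.
  - cbn [iterate profile]. ring.
  - cbn [iterate profile].
    rewrite (is_RInt_unique (V := C_R_CompleteNormedModule) _ _ _ _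
      (is_RInt_correction_wave _ _ IH (smooth_profile N n) N r t)).
    rewrite IH, RtoC_plus. ring.
Qed.

Lemma Cmod_expi t : Cmod (expi t) = 1.
Proof.
  unfold Cmod, expi. simpl fst. simpl snd.
  replace (cos t ^ 2 + sin t ^ 2) with 1; [apply sqrt_1|].
  pose proof (sin2_cos2 t). unfold Rsqr in *. lra.
Qed.

Lemma iterate_cvg_uniformly N rho : (1 <= N)%nat -> 0 < rho ->
  cvg_uniformly_on (fun r _ => - rho <= r <= rho) (iterate N) airy_wave.
Proof.
  intros HN Hrho eps Heps.
  destruct (profile_error_bound N rho HN Hrho) as [C [HC HB]].
  destruct (pow_lt_1_zero (/ 2)) with (y := eps / C) as [n0 Hn0].
  { rewrite Rabs_pos_eq; lra. }
  { now apply Rdiv_lt_0_compat. }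
  exists n0. intros n Hn r t Hr.
  rewrite iterate_profile. unfold airy_wave. fold Airy.
  replace (expi t * RtoC (profile N n r) - expi t * RtoC (Airy r))%C
    with (expi t * RtoC (profile N n r - Airy r))%C.
  2: { rewrite RtoC_minus. ring. }
  (* As e^(it) has modulus 1, the estimate is uniform in t. *)
  rewrite Cmod_mult, Cmod_expi, Rmult_1_l, Cmod_R.
  eapply Rle_lt_trans; [apply HB, Rabs_le_between, Hr|].
  specialize (Hn0 n Hn). rewrite Rabs_pos_eq in Hn0 by (apply pow_le; lra).
  replace eps with (C * (eps / C)) by (field; lra).
  now apply Rmult_lt_compat_l.
Qed.

(** * Differentiation and continuity of complex-valued functions *)

Lemma is_derive_pair (f g : R -> R) x f' g' :
  is_derive f x f' -> is_derive g x g' ->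
  is_derive_C (fun y => (f y, g y)) x (f', g').
Proof.
  intros Hf Hg.
  apply (filterdiff_comp_2 (U := R_NormedModule) (V := R_NormedModule) (W := C_R_NormedModule)
    f g pair _ _ pair Hf Hg).
  apply (filterdiff_ext (fun t : R * R => t)); [now intros []|].
  apply (filterdiff_ext_lin _ (fun t : R * R => t)); [|now intros []].
  apply filterdiff_id.
Qed.

Lemma is_derive_C_half f x l : 0 <= x -> is_derive_C f x l -> is_derive_half f x l.
Proof.
  intros Hx [Hl Hf]. split; [exact Hl|].
  intros z Hz.
  (* Differentiability along a filter is tested at each limit z of the filter. Since x lies in the
     half-line, x is within every distance of z, so z = x. *)
  assert (E : x = z).
  { apply eq_close. intros eps.
    destruct (Hz (ball z eps) (locally_ball z eps)) as [d Hd].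
    apply ball_sym, Hd; [apply ball_center|exact Hx]. }
  intros eps. apply filter_le_within.
  apply Hf. now rewrite <- E.
Qed.

Lemma continuous_pair (f g : R * R -> R) p :
  continuous f p -> continuous g p ->
  continuous (U := C_UniformSpace) (fun q => (f q, g q)) p.
Proof.
  intros Hf Hg.
  apply (continuous_comp_2 (V := R_UniformSpace) (W := R_UniformSpace) (X := C_UniformSpace) f g pair p Hf Hg).
  apply (continuous_ext (fun t : R * R => t)); [now intros []|].
  apply continuous_id.
Qed.

Lemma continuous_tensor (h g : R -> R) p :
  continuous h (snd p) -> continuous g (fst p) ->
  continuous (fun q : R * R => h (snd q) * g (fst q)) p.
Proof.
  intros Hh Hg. destruct p as [r t].
  apply (continuous_mult (K := R_AbsRing) (fun q : R * R => h (snd q)) (fun q : R * R => g (fst q))).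
  - apply (continuous_comp snd h); [apply continuous_snd|exact Hh].
  - apply (continuous_comp fst g); [apply continuous_fst|exact Hg].
Qed.

(** * The limit as a classical solution *)

(** In coordinates, [wave] is e^(it) g(r) and [wave_t] below is i e^(it) g(r). Together they are
    closed under both partial derivatives. *)
Definition wave (g : R -> R) (r t : R) : C := (cos t * g r, sin t * g r).

Definition wave_t (g : R -> R) (r t : R) : C := (- sin t * g r, cos t * g r).

Lemma is_derive_wave_r g r t :
  smooth g -> is_derive_C (fun x => wave g x t) r (wave (Derive g) r t).
Proof.
  intros Hg. apply is_derive_pair;
    apply (is_derive_scal g); apply smooth_is_derive, Hg.
Qed.

Lemma is_derive_wave_t_r g r t :
  smooth g -> is_derive_C (fun x => wave_t g x t) r (wave_t (Derive g) r t).
Proof.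
  intros Hg. apply is_derive_pair;
    apply (is_derive_scal g); apply smooth_is_derive, Hg.
Qed.

Lemma is_derive_wave_t g r t : is_derive_C (fun y => wave g r y) t (wave_t g r t).
Proof. apply is_derive_pair; auto_derive; auto; ring. Qed.

Lemma is_derive_wave_tt g r t :
  is_derive_C (fun y => wave_t g r y) t (wave (fun x => - 1 * g x) r t).
Proof. apply is_derive_pair; auto_derive; auto; simpl; ring. Qed.

Lemma continuous_on_wave D g : smooth g -> continuous_on_C D (wave g).
Proof.
  intros Hg. apply continuous_on_forall. intros p _.
  apply continuous_pair; apply (continuous_tensor _ g);
    auto using smooth_continuous, continuous_cos, continuous_sin.
Qed.

Lemma continuous_on_wave_t D g : smooth g -> continuous_on_C D (wave_t g).
Proof.
  intros Hg. apply continuous_on_forall. intros p _.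
  apply continuous_pair.
  - apply (continuous_tensor (fun t => - sin t) g); auto using smooth_continuous.
    apply (continuous_opp (V := R_NormedModule) sin), continuous_sin.
  - apply (continuous_tensor cos g); auto using smooth_continuous, continuous_cos.
Qed.

Lemma airy_wave_eq r t : airy_wave r t = wave Airy r t.
Proof.
  unfold airy_wave, wave. fold Airy. apply injective_projections; simpl; ring.
Qed.

Lemma KG_solution_airy_wave : KG_solution airy_wave.
Proof.
  assert (S := smooth_Airy).
  assert (S1 := smooth_Derive _ S). assert (S2 := smooth_Derive _ S1).
  assert (SN : smooth (fun r => - 1 * Airy r)).
  { apply (smooth_mult (fun _ => -1)); auto using smooth_const. }
  (* The partial derivatives of e^(it) f(r): both mixed ones are i e^(it) f', and u_tt = - e^(it)
     f. *)
  exists (wave (Derive Airy)), (wave_t Airy), (wave (Derive (Derive Airy))),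
    (wave_t (Derive Airy)), (wave_t (Derive Airy)), (wave (fun r => - 1 * Airy r)).
  split; [|split].
  - intros r t Hr. split.
    + apply (is_derive_C_half _ _ _ Hr).
      apply (is_derive_ext (V := C_R_NormedModule) (fun x => wave Airy x t)).
      * intros x. now rewrite airy_wave_eq.
      * now apply is_derive_wave_r.
    + apply (is_derive_ext (V := C_R_NormedModule) (fun y => wave Airy r y)).
      * intros y. now rewrite airy_wave_eq.
      * apply is_derive_wave_t.
  - intros r t _. split; [|split; [|split]].
    + now apply is_derive_wave_r.
    + apply is_derive_wave_t.
    + now apply is_derive_wave_t_r.
    + apply is_derive_wave_tt.
  - do 6 (split; [now apply continuous_on_wave || now apply continuous_on_wave_t|]).
    split; [|split].
    + intros r t _. rewrite airy_wave_eq.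
      pose proof (Airy_ode r) as E. unfold wave.
      assert (E' : Derive (Derive Airy) r = - Airy r - r * Airy r) by lra.
      rewrite E'. apply injective_projections; simpl; ring.
    + intros t. rewrite airy_wave_eq. unfold wave. rewrite Airy_0.
      unfold expi. f_equal; ring.
    + intros t. unfold wave. rewrite Derive_Airy_0.
      apply injective_projections; simpl; ring.
Qed.

(** * Uniqueness *)

(** A mean value inequality: phi + f and phi - f have nonnegative derivatives inside the interval,
    hence do not decrease. At 0 only continuity of f from the right is assumed. *)
Lemma growth_bound f f' phi phi' r : 0 < r ->
  (forall x, 0 < x <= r -> is_derive f x (f' x)) ->
  filterlim f (within (fun x => 0 <= x) (locally 0)) (locally (f 0)) ->
  f 0 = 0 ->
  (forall x, is_derive phi x (phi' x)) ->
  (forall x, 0 < x < r -> Rabs (f' x) <= phi' x) ->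
  Rabs (f r) <= phi r - phi 0.
Proof.
  intros Hr Hf H0 Hf0 Hphi Hb.
  (* F continues f by the constant f(0) to the left, which supplies the two-sided continuity at 0
     that the mean value theorem asks for. *)
  set (F := fun x => f (Rmax 0 x)).
  assert (FE : forall x, 0 <= x -> F x = f x).
  { intros x Hx. unfold F. now rewrite Rmax_right. }
  assert (DF : forall x, 0 < x <= r -> is_derive F x (f' x)).
  { intros x Hx. apply (is_derive_ext_loc f); [|now apply Hf].
    apply (filter_imp (fun y => 0 < y)); [|now apply (open_gt 0)].
    intros y Hy. symmetry. apply FE. lra. }
  assert (CF : forall x, 0 <= x <= r -> continuous F x).
  { intros x [[Hx|<-] Hx'].
    - apply (ex_derive_continuous F). exists (f' x). auto.
    - unfold continuous. rewrite FE by lra.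
      apply (filterlim_comp _ _ _ (Rmax 0) f _ (within (fun x => 0 <= x) (locally 0))); [|exact H0].
      intros P [d Hd]. exists d. intros y Hy. apply Hd; [|apply Rmax_l].
      change (Rabs (Rmax 0 y - 0) < d). change (Rabs (y - 0) < d) in Hy.
      revert Hy. unfold Rmax. destruct (Rle_dec 0 y); intros Hy; auto.
      rewrite Rminus_0_r, Rabs_R0. apply cond_pos. }
  assert (Main : forall e, Rabs e = 1 -> 0 <= phi r + e * F r - (phi 0 + e * F 0)).
  { intros e He.
    (* The values of the derivative at the endpoints are immaterial, but MVT_gen may
       return an endpoint: the truncation at 0 makes them nonnegative. *)
    destruct (MVT_gen (fun x => phi x + e * F x) 0 r
      (fun x => Rmax 0 (phi' x + e * f' x))) as [c [_ Hc]].
    - rewrite Rmin_left, Rmax_right by lra. intros x Hx.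
      assert (Hbx := Hb x Hx).
      assert (Rabs (e * f' x) <= phi' x) by (rewrite Rabs_mult, He; lra).
      apply Rabs_le_between in H.
      rewrite Rmax_right by lra.
      apply (is_derive_plus phi (fun x => e * F x)); auto.
      apply (is_derive_scal F). apply DF. lra.
    - rewrite Rmin_left, Rmax_right by lra. intros x Hx.
      apply continuity_pt_filterlim.
      apply (continuous_plus (V := R_NormedModule) phi (fun x => e * F x)).
      + apply (ex_derive_continuous phi). eexists; apply Hphi.
      + apply (continuous_scal_r (V := R_NormedModule) e F). auto.
    - rewrite Hc. apply Rmult_le_pos; [apply Rmax_l|lra]. }
  rewrite !FE in Main by lra. rewrite Hf0 in Main.
  assert (M1 := Main 1 Rabs_R1).
  assert (M2 := Main (Ropp 1)). rewrite Rabs_Ropp, Rabs_R1 in M2. specialize (M2 eq_refl).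
  apply Rabs_le. lra.
Qed.

Definition continuous_on_R (D : R -> Prop) (F : R -> R -> R) : Prop :=
  continuous_on (T := prod_UniformSpace R_UniformSpace R_UniformSpace)
    (U := R_UniformSpace) (fun p => D (fst p)) (fun p => F (fst p) (snd p)).

(** Compactness with a gauge chosen at most 1 / (|F| + 1) at each centre: a uniform d below the
    gauge at some nearby centre gives |F| + 1 <= 1 / d there, and |F| at the point is at most |F| +
    1 at that centre. *)
Lemma continuous_on_rectangle_bounded F a b c :
  continuous_on_R (fun r => 0 <= r) F ->
  exists A, 0 <= A /\
    forall r t, 0 <= r <= a -> b <= t <= c -> Rabs (F r t) <= A.
Proof.
  intros HF.
  assert (Ex : forall u v, exists d : posreal, 0 <= u ->
    d <= / (Rabs (F u v) + 1) /\
    forall x y, 0 <= x -> Rabs (x - u) < d -> Rabs (y - v) < d ->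
      Rabs (F x y) <= Rabs (F u v) + 1).
  { intros u v. destruct (Rle_dec 0 u) as [Hu|Hu].
    2: { exists (mkposreal 1 Rlt_0_1). intros; lra. }
    destruct (HF (u, v) Hu (ball (F u v) 1)) as [d Hd].
    { exact (locally_ball (F u v) (mkposreal 1 Rlt_0_1)). }
    assert (Hpos : 0 < / (Rabs (F u v) + 1)).
    { apply Rinv_0_lt_compat. pose proof (Rabs_pos (F u v)). lra. }
    exists (mkposreal _ (Rmin_pos _ _ (cond_pos d) Hpos)). intros _. simpl.
    split; [apply Rmin_r|].
    intros x y Hx Hxu Hyv.
    assert (HB : ball (F u v) 1 (F x y)).
    { apply (Hd (x, y)); auto. split; simpl.
      - eapply Rlt_le_trans; [exact Hxu|apply Rmin_l].
      - eapply Rlt_le_trans; [exact Hyv|apply Rmin_l]. }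
    change (Rabs (F x y - F u v) < 1) in HB.
    pose proof (Rabs_triang_inv (F x y) (F u v)). lra. }
  set (delta := fun u v => proj1_sig (constructive_indefinite_description _ (Ex u v))).
  destruct (compactness_value_2d 0 a b c delta) as [d Hd].
  exists (/ d). split; [left; apply Rinv_0_lt_compat, cond_pos|].
  (* The compactness principle yields its centre only under a double negation, hence the argument by
     contradiction. *)
  intros r t Hr Ht. apply Rnot_lt_le. intros Hlt.
  apply (Hd r t Hr Ht). intros [u [v [Hu [Hv [H1 [H2 H3]]]]]].
  unfold delta in *.
  destruct (constructive_indefinite_description _ (Ex u v)) as [e He]. simpl in *.
  destruct (He (proj1 Hu)) as [He1 He2].
  assert (HB := He2 r t (proj1 Hr) H1 H2).
  assert (d <= / (Rabs (F u v) + 1)) by lra.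
  assert (Hp : 0 < Rabs (F u v) + 1) by (pose proof (Rabs_pos (F u v)); lra).
  apply Rinv_le_contravar in H; [|apply cond_pos].
  rewrite Rinv_inv in H. lra.
Qed.

(** The problem for one real component. The boundary value g is a parameter, so that real parts,
    imaginary parts and differences of solutions all fit; at r = 0 the function u is asked to be
    continuous from the right in r. *)
Definition real_KG_solution (g : R -> R) (u : R -> R -> R) : Prop :=
  exists ur ut urr urt utr utt : R -> R -> R,
    (forall r t, 0 < r -> is_derive (fun x => u x t) r (ur r t)) /\
    (forall t, filterlim (fun x => u x t)
       (within (fun x => 0 <= x) (locally 0)) (locally (u 0 t))) /\
    (forall r t, 0 <= r -> is_derive (fun y => u r y) t (ut r t)) /\
    (forall r t, 0 < r ->
       is_derive (fun x => ur x t) r (urr r t) /\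
       is_derive (fun y => ur r y) t (urt r t) /\
       is_derive (fun x => ut x t) r (utr r t) /\
       is_derive (fun y => ut r y) t (utt r t)) /\
    continuous_on_R (fun r => 0 <= r) ur /\
    continuous_on_R (fun r => 0 <= r) ut /\
    continuous_on_R (fun r => 0 < r) urr /\
    continuous_on_R (fun r => 0 < r) urt /\
    continuous_on_R (fun r => 0 < r) utr /\
    (forall r t, 0 < r -> urr r t - utt r t + r * u r t = 0) /\
    (forall t, u 0 t = g t) /\
    (forall t, ur 0 t = 0).

Lemma locally_fst_pos (p : R * R) : 0 < fst p -> locally p (fun q => 0 < fst q).
Proof.
  intros Hp. exists (mkposreal _ Hp). intros q [Hq _].
  change (Rabs (fst q - fst p) < fst p) in Hq.
  apply Rabs_lt_between' in Hq. lra.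
Qed.

Lemma continuous_on_R_pos F (p : R * R) : continuous_on_R (fun r => 0 < r) F ->
  0 < fst p -> continuous (fun q : R * R => F (fst q) (snd q)) p.
Proof.
  intros HF Hp P HP. assert (H := HF p Hp P HP).
  unfold filtermap, within in *.
  generalize (filter_and _ _ H (locally_fst_pos p Hp)).
  apply filter_imp. intros q [H1 H2]. auto.
Qed.

(** Schwarz's theorem, whose [Derive] terms agree with the given partial derivatives on a
    neighbourhood inside r > 0. *)
Lemma mixed_partials_eq u ur ut urt utr :
  (forall r t, 0 < r -> is_derive (fun x => u x t) r (ur r t)) ->
  (forall r t, 0 < r -> is_derive (fun y => u r y) t (ut r t)) ->
  (forall r t, 0 < r -> is_derive (fun y => ur r y) t (urt r t)) ->
  (forall r t, 0 < r -> is_derive (fun x => ut x t) r (utr r t)) ->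
  continuous_on_R (fun r => 0 < r) urt ->
  continuous_on_R (fun r => 0 < r) utr ->
  forall r t, 0 < r -> utr r t = urt r t.
Proof.
  intros Hur Hut Hurt Hutr Curt Cutr r t Hr.
  assert (L : forall x, 0 < x -> locally x (fun y => 0 < y)).
  { intros x Hx. now apply (open_gt 0). }
  assert (L2 : locally_2d (fun x _ => 0 < x) r t).
  { apply locally_2d_locally. apply (locally_fst_pos (r, t)), Hr. }
  assert (Dtr : forall x y, 0 < x ->
    is_derive (fun z => Derive (fun s => u z s) y) x (utr x y)).
  { intros x y Hx. apply (is_derive_ext_loc (fun z => ut z y)); auto.
    apply (filter_imp (fun z => 0 < z)); auto.
    intros z Hz. symmetry. apply is_derive_unique. auto. }
  assert (Drt : forall x y, 0 < x ->
    is_derive (fun z => Derive (fun s => u s z) x) y (urt x y)).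
  { intros x y Hx. apply (is_derive_ext (fun z => ur x z)); auto.
    intros z. symmetry. apply is_derive_unique. auto. }
  rewrite <- (is_derive_unique _ _ _ (Dtr r t Hr)), <- (is_derive_unique _ _ _ (Drt r t Hr)).
  apply Schwarz.
  - revert L2. apply locally_2d_impl, locally_2d_forall. intros x y Hx.
    repeat split; eexists; eauto.
  - apply (continuity_2d_pt_ext_loc utr).
    + revert L2. apply locally_2d_impl, locally_2d_forall. intros x y Hx.
      symmetry. apply is_derive_unique. auto.
    + apply continuity_2d_pt_filterlim. apply (continuous_on_R_pos utr (r, t)); auto.
  - apply (continuity_2d_pt_ext_loc urt).
    + revert L2. apply locally_2d_impl, locally_2d_forall. intros x y Hx.
      symmetry. apply is_derive_unique. auto.
    + apply continuity_2d_pt_filterlim. apply (continuous_on_R_pos urt (r, t)); auto.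
Qed.

(** Chain rule on the line t + e s = a. Joint differentiability follows from the existence of both
    partial derivatives and the continuity of Fr. *)
Lemma is_derive_along_line (F Fr Ft : R -> R -> R) a e x :
  (forall r t, 0 < r -> is_derive (fun y => F y t) r (Fr r t)) ->
  (forall r t, 0 < r -> is_derive (fun y => F r y) t (Ft r t)) ->
  continuous_on_R (fun r => 0 < r) Fr ->
  0 < x ->
  is_derive (fun s => F s (a - e * s)) x (Fr x (a - e * x) - e * Ft x (a - e * x)).
Proof.
  intros HFr HFt CFr Hx.
  assert (D := is_derive_filterdiff F x (a - e * x) Fr (Ft x (a - e * x))).
  assert (Dl : is_derive (fun s => a - e * s) x (- e)) by (auto_derive; auto; ring).
  apply (filterdiff_ext_lin (U := R_NormedModule) (V := R_NormedModule) _ (fun h : R =>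
    plus (scal h (Fr x (a - e * x))) (scal (scal h (- e)) (Ft x (a - e * x))))).
  - apply (filterdiff_comp'_2 (fun s => s) (fun s => a - e * s) F x (fun h : R => h)
      (fun h : R => scal h (- e))
      (fun h k : R => plus (scal h (Fr x (a - e * x))) (scal k (Ft x (a - e * x))))).
    + apply filterdiff_id.
    + exact Dl.
    + apply D; auto.
      * apply (filter_imp (fun q : R * R => 0 < fst q)); auto.
        apply (locally_fst_pos (x, a - e * x)), Hx.
      * now apply (continuous_on_R_pos Fr (x, a - e * x)).
  - intros h. change plus with Rplus. change scal with Rmult. simpl. ring.
Qed.

Lemma continuous_along_line F a e :
  continuous_on_R (fun r => 0 <= r) F ->
  filterlim (fun s => F s (a - e * s))
    (within (fun s => 0 <= s) (locally 0)) (locally (F 0 (a - e * 0))).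
Proof.
  intros HF P HP. assert (H := HF (0, a - e * 0) (Rle_refl 0) P HP).
  unfold filtermap, within in *.
  assert (C : continuous (U := prod_UniformSpace R_UniformSpace R_UniformSpace)
    (fun s => (s, a - e * s)) 0).
  { apply (continuous_comp_2 (V := R_UniformSpace) (W := R_UniformSpace)
      (X := prod_UniformSpace R_UniformSpace R_UniformSpace)
      (fun s => s) (fun s => a - e * s) pair 0).
    - apply continuous_id.
    - apply (ex_derive_continuous (fun s => a - e * s)). auto_derive. auto.
    - apply (continuous_ext (fun t : R * R => t)); [now intros []|].
      apply continuous_id. }
  assert (H' := C _ H). unfold filtermap in H'.
  revert H'. apply filter_imp. auto.
Qed.

(* The Riemann invariants u_r + e u_t, e = 1 or -1, have derivative - s u along
   the characteristics t + e s = const. *)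
Lemma real_KG_solution_zero u :
  real_KG_solution (fun _ => 0) u -> forall r t, 0 <= r -> u r t = 0.
Proof.
  intros [ur [ut [urr [urt [utr [utt [Hur [Hu0 [Hut [H2 [Cur [Cut [Curr [Curt [Cutr
    [Hpde [Hi Hi']]]]]]]]]]]]]]]]] r0 t0 Hr0.
  destruct Hr0 as [Hr0|<-]; [|apply Hi].
  assert (Hmix : forall r t, 0 < r -> utr r t = urt r t).
  { apply (mixed_partials_eq u ur ut); auto; try (intros; apply H2; assumption).
    intros; apply Hut; lra. }
  assert (Hut0 : forall t, ut 0 t = 0).
  { intros t. rewrite <- (is_derive_unique _ _ _ (Hut 0 t (Rle_refl 0))).
    rewrite (Derive_ext _ (fun _ => 0)); [apply Derive_const|exact Hi]. }
  (* The triangle with apex (r0, t0) and base on r = 0; a characteristic followed towards r = 0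
     stays inside it. *)
  set (cone := fun r t => 0 <= r /\ r <= r0 /\ Rabs (t - t0) <= r0 - r).
  (* Two integrations cost r0 / L^2, and this L satisfies L^2 >= 2 r0, so the factor is at most
     1/2. *)
  set (L := 2 * r0 + 2).
  assert (HL : 0 < L) by (unfold L; lra).
  assert (Char : forall B, 0 <= B ->
    (forall r t, cone r t -> Rabs (u r t) <= B * exp (L * r)) ->
    forall e r t, Rabs e = 1 -> e * e = 1 -> cone r t -> 0 < r ->
    Rabs (ur r t + e * ut r t) <= r0 * B / L * exp (L * r)).
  { intros B HB0 HB e r t He He2 [_ [Hr Ht]] Hr'.
    set (a := t + e * r).
    set (f := fun s => ur s (a - e * s) + e * ut s (a - e * s)).
    replace (ur r t + e * ut r t) with (f r).
    2: { unfold f, a. now replace (t + e * r - e * r) with t by ring. }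
    apply Rle_trans with (r0 * B / L * exp (L * r) - r0 * B / L * exp (L * 0)).
    2: { assert (0 <= r0 * B / L * exp (L * 0)); [|lra].
         apply Rmult_le_pos; [|left; apply exp_pos].
         apply Rdiv_le_0_compat; auto. apply Rmult_le_pos; lra. }
    apply (growth_bound f (fun s => - s * u s (a - e * s))
      (fun s => r0 * B / L * exp (L * s)) (fun s => r0 * B * exp (L * s))); auto.
    - intros x Hx.
      (* The mixed derivatives cancel and e^2 = 1, which leaves u_rr - u_tt = - x u. *)
      assert (E : - x * u x (a - e * x) =
        (urr x (a - e * x) - e * urt x (a - e * x))
        + e * (utr x (a - e * x) - e * utt x (a - e * x))).
      { rewrite Hmix by lra. pose proof (Hpde x (a - e * x) (proj1 Hx)).
        replace (urr x (a - e * x) - e * urt x (a - e * x) +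
          e * (urt x (a - e * x) - e * utt x (a - e * x)))
          with (urr x (a - e * x) - (e * e) * utt x (a - e * x)) by ring.
        rewrite He2. lra. }
      rewrite E.
      apply (is_derive_plus (V := R_NormedModule) (fun s => ur s (a - e * s))
        (fun s => e * ut s (a - e * s))).
      + apply is_derive_along_line; auto; try (intros; apply H2; assumption). lra.
      + apply (is_derive_scal (fun s => ut s (a - e * s))).
        apply is_derive_along_line; auto; try (intros; apply H2; assumption). lra.
    - apply (filterlim_comp_2 (G := locally (ur 0 (a - e * 0))) (H := locally (e * ut 0 (a - e * 0)))
        (fun s => ur s (a - e * s)) (fun s => e * ut s (a - e * s)) Rplus).
      + now apply continuous_along_line.
      + apply (filterlim_comp _ _ _ (fun s => ut s (a - e * s)) (Rmult e) _
          (locally (ut 0 (a - e * 0)))).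
        * now apply continuous_along_line.
        * apply (continuous_scal_r (V := R_NormedModule) e (fun x => x)), continuous_id.
      + apply (filterlim_plus (V := R_NormedModule)).
    - unfold f. rewrite Hi', Hut0, Rmult_0_r. apply Rplus_0_r.
    - intros x. auto_derive; auto. field. lra.
    - intros x Hx. rewrite Rabs_mult, Rabs_Ropp, Rabs_pos_eq by lra.
      rewrite Rmult_assoc. apply Rmult_le_compat; try lra; [apply Rabs_pos|].
      apply HB. split; [|split]; try lra.
      replace (a - e * x - t0) with ((t - t0) + e * (r - x)) by (unfold a; ring).
      eapply Rle_trans; [apply Rabs_triang|].
      rewrite Rabs_mult, He, (Rabs_pos_eq (r - x)); lra. }
  assert (Half : forall B, 0 <= B ->
    (forall r t, cone r t -> Rabs (u r t) <= B * exp (L * r)) ->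
    forall r t, cone r t -> Rabs (u r t) <= B / 2 * exp (L * r)).
  { intros B HB0 HB r t Hc.
    destruct (proj1 Hc) as [Hr|<-].
    2: { rewrite Hi, Rabs_R0. apply Rmult_le_pos; [lra|left; apply exp_pos]. }
    assert (HD : 0 <= r0 * B / (L * L)).
    { apply Rdiv_le_0_compat; [apply Rmult_le_pos; lra|nra]. }
    apply Rle_trans with (r0 * B / (L * L) * exp (L * r) - r0 * B / (L * L) * exp (L * 0)).
    - apply (growth_bound (fun s => u s t) (fun s => ur s t)
        (fun s => r0 * B / (L * L) * exp (L * s)) (fun s => r0 * B / L * exp (L * s)));
        auto.
      + intros x Hx. apply Hur. lra.
      + intros x. auto_derive; auto. field. lra.
      + intros x Hx.
        assert (Hcx : cone x t) by (destruct Hc as [? [? ?]]; split; [|split]; lra).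
        assert (C1 := Char B HB0 HB 1 x t Rabs_R1 (Rmult_1_l 1) Hcx (proj1 Hx)).
        assert (C2 := Char B HB0 HB (Ropp 1) x t).
        rewrite Rabs_Ropp, Rabs_R1 in C2.
        assert (E : - (1) * - (1) = 1) by ring.
        specialize (C2 eq_refl E Hcx (proj1 Hx)).
        (* As the mean of the two invariants, u_r inherits their common bound. *)
        apply Rabs_le_between in C1. apply Rabs_le_between in C2.
        apply Rabs_le. lra.
    - assert (0 <= r0 * B / (L * L) * exp (L * 0)).
      { apply Rmult_le_pos; [auto|left; apply exp_pos]. }
      assert (r0 * B / (L * L) <= B / 2).
      { apply (Rmult_le_reg_r (2 * (L * L))); [nra|].
        replace (r0 * B / (L * L) * (2 * (L * L))) with (B * (2 * r0)) by (field; lra).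
        replace (B / 2 * (2 * (L * L))) with (B * (L * L)) by field.
        apply Rmult_le_compat_l; auto. unfold L. nra. }
      pose proof (exp_pos (L * r)). nra. }
  (* A bound A of |u_r| on a rectangle containing the triangle starts the iteration with |u| <= A
     r0. *)
  destruct (continuous_on_rectangle_bounded ur r0 (t0 - r0) (t0 + r0) Cur) as [A [HA0 HA]].
  assert (Iter : forall n r t, cone r t ->
    Rabs (u r t) <= A * r0 * (/ 2) ^ n * exp (L * r)).
  { induction n as [|n IH]; intros r t Hc.
    - simpl pow. rewrite Rmult_1_r.
      destruct (proj1 Hc) as [Hr|<-].
      2: { rewrite Hi, Rabs_R0. apply Rmult_le_pos; [nra|left; apply exp_pos]. }
      destruct Hc as [_ [Hr' Ht]]. apply Rabs_le_between in Ht.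
      assert (G : Rabs (u r t) <= A * r - A * 0).
      { apply (growth_bound (fun s => u s t) (fun s => ur s t) (fun s => A * s) (fun _ => A)); auto.
        - intros x Hx. apply Hur. lra.
        - intros x. auto_derive; auto. ring.
        - intros x Hx. apply HA; lra. }
      assert (A * r <= A * r0) by (apply Rmult_le_compat_l; lra).
      assert (1 <= exp (L * r)).
      { pose proof (exp_ineq1_le (L * r)). nra. }
      assert (0 <= A * r0) by nra. nra.
    - replace (A * r0 * (/ 2) ^ S n) with (A * r0 * (/ 2) ^ n / 2) by (simpl; field).
      apply Half; auto.
      apply Rmult_le_pos; [nra|apply pow_le; lra]. }
  apply cond_eq. intros eps Heps. rewrite Rminus_0_r.
  (* The iteration gives |u(r0, t0)| <= K / 2^n for every n; the summand 1 permits division by K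
     when A = 0. *)
  set (K := A * r0 * exp (L * r0) + 1).
  assert (HK : 0 < K).
  { unfold K. pose proof (exp_pos (L * r0)). assert (0 <= A * r0) by nra. nra. }
  destruct (pow_lt_1_zero (/ 2)) with (y := eps / K) as [n Hn].
  { rewrite Rabs_pos_eq; lra. }
  { now apply Rdiv_lt_0_compat. }
  specialize (Hn n (Nat.le_refl n)).
  assert (Hp : 0 < (/ 2) ^ n) by (apply pow_lt; lra).
  rewrite Rabs_pos_eq in Hn by lra.
  assert (Hc : cone r0 t0).
  { split; [|split]; try lra. rewrite Rminus_diag, Rabs_R0. lra. }
  apply Rle_lt_trans with (K * (/ 2) ^ n).
  - eapply Rle_trans; [apply (Iter n _ _ Hc)|]. unfold K.
    replace (A * r0 * (/ 2) ^ n * exp (L * r0)) with (A * r0 * exp (L * r0) * (/ 2) ^ n) by ring.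
    nra.
  - replace eps with (K * (eps / K)) by (field; lra).
    now apply Rmult_lt_compat_l.
Qed.

(** * From zero data to complex solutions: differences, real and imaginary parts *)

Lemma continuous_on_R_minus D F G :
  continuous_on_R D F -> continuous_on_R D G ->
  continuous_on_R D (fun r t => F r t - G r t).
Proof.
  intros HF HG p Hp.
  apply (filterlim_comp_2 (G := locally (F (fst p) (snd p)))
    (H := locally (opp (G (fst p) (snd p))))
    (fun q => F (fst q) (snd q)) (fun q => opp (G (fst q) (snd q))) plus).
  - now apply HF.
  - eapply filterlim_comp; [now apply HG|].
    apply (filterlim_opp (V := R_NormedModule)).
  - apply (filterlim_plus (V := R_NormedModule)).
Qed.

Lemma real_KG_solution_unique g u v :
  real_KG_solution g u -> real_KG_solution g v ->
  forall r t, 0 <= r -> u r t = v r t.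
Proof.
  intros [ur [ut [urr [urt [utr [utt [Hur [Hu0 [Hut [H2 [Cur [Cut [Curr [Curt [Cutr
    [Hpde [Hi Hi']]]]]]]]]]]]]]]]].
  intros [vr [vt [vrr [vrt [vtr [vtt [Kvr [Kv0 [Kvt [K2 [Dvr [Dvt [Dvrr [Dvrt [Dvtr
    [Kpde [Ki Ki']]]]]]]]]]]]]]]]].
  intros r t Hr. apply Rminus_diag_uniq.
  apply (real_KG_solution_zero (fun r t => u r t - v r t)); auto.
  exists (fun r t => ur r t - vr r t), (fun r t => ut r t - vt r t),
    (fun r t => urr r t - vrr r t), (fun r t => urt r t - vrt r t),
    (fun r t => utr r t - vtr r t), (fun r t => utt r t - vtt r t).
  clear r t Hr.
  split; [|split; [|split; [|split]]].
  - intros r t Hr. apply (is_derive_minus (fun x => u x t) (fun x => v x t)); auto.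
  - intros t.
    apply (filterlim_comp_2 (G := locally (u 0 t)) (H := locally (opp (v 0 t)))
      (fun x => u x t) (fun x => opp (v x t)) plus).
    + apply Hu0.
    + eapply filterlim_comp; [apply Kv0|].
      apply (filterlim_opp (V := R_NormedModule)).
    + apply (filterlim_plus (V := R_NormedModule)).
  - intros r t Hr. apply (is_derive_minus (fun y => u r y) (fun y => v r y)); auto.
  - intros r t Hr.
    destruct (H2 r t Hr) as [A1 [A2 [A3 A4]]]. destruct (K2 r t Hr) as [B1 [B2 [B3 B4]]].
    split; [|split; [|split]].
    + apply (is_derive_minus (fun x => ur x t) (fun x => vr x t)); auto.
    + apply (is_derive_minus (fun y => ur r y) (fun y => vr r y)); auto.
    + apply (is_derive_minus (fun x => ut x t) (fun x => vt x t)); auto.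
    + apply (is_derive_minus (fun y => ut r y) (fun y => vt r y)); auto.
  - do 5 (split; [now apply continuous_on_R_minus|]).
    split; [|split].
    + intros r t Hr. specialize (Hpde r t Hr). specialize (Kpde r t Hr). lra.
    + intros t. rewrite Hi, Ki. ring.
    + intros t. rewrite Hi', Ki'. ring.
Qed.

(** For x > 0 the half-line is a neighbourhood of x, so the restriction of the filter has no
    effect. *)
Lemma is_derive_half_pos f x l : 0 < x -> is_derive_half f x l -> is_derive_C f x l.
Proof.
  intros Hx [Hl Hf]. split; [exact Hl|]. intros z Hz eps.
  assert (Hlim : is_filter_lim (within (fun y => 0 <= y) (locally x)) z).
  { intros P HP. apply filter_le_within. now apply Hz. }
  assert (H := Hf z Hlim eps). unfold within in H.
  generalize (filter_and _ _ H (open_gt 0 x Hx)).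
  apply filter_imp. intros y [H1 H2]. apply H1. lra.
Qed.

Section LinearFunctional.

(** Here [pi] is not the circle constant but the real or the imaginary part. Both are real-linear
    and therefore respect the equation, whose coefficients are real. *)
Variable pi : C -> R.
Hypothesis pi_linear : is_linear (U := C_R_NormedModule) (V := R_NormedModule) pi.
Hypothesis pi_operator : forall a b c x,
  pi (a - b + RtoC x * c)%C = pi a - pi b + x * pi c.
Hypothesis pi_0 : pi (RtoC 0) = 0.

Lemma is_derive_functional f x l :
  is_derive_C f x l -> is_derive (fun y => pi (f y)) x (pi l).
Proof.
  intros H.
  apply (filterdiff_ext_lin _ (fun h => pi (scal (V := C_R_NormedModule) h l))).
  - apply (filterdiff_comp (U := R_NormedModule) (V := C_R_NormedModule) f pi); [exact H|].
    now apply filterdiff_linear.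
  - intros h. apply (linear_scal (U := C_R_NormedModule) (V := R_NormedModule) pi pi_linear h l).
Qed.

Lemma continuous_on_functional D F :
  continuous_on_C D F -> continuous_on_R D (fun r t => pi (F r t)).
Proof.
  intros H p Hp. eapply filterlim_comp; [now apply H|].
  apply (linear_cont (U := C_R_NormedModule) (V := R_NormedModule) pi), pi_linear.
Qed.

Lemma KG_solution_functional v : KG_solution v ->
  real_KG_solution (fun t => pi (expi t)) (fun r t => pi (v r t)).
Proof.
  intros [vr [vt [vrr [vrt [vtr [vtt [H1 [H2 [Cr [Ct [Crr [Crt [Ctr [_
    [Hpde [Hi Hi']]]]]]]]]]]]]]]].
  exists (fun r t => pi (vr r t)), (fun r t => pi (vt r t)),
    (fun r t => pi (vrr r t)), (fun r t => pi (vrt r t)),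
    (fun r t => pi (vtr r t)), (fun r t => pi (vtt r t)).
  split; [|split; [|split; [|split]]].
  - intros r t Hr. apply (is_derive_functional (fun x => v x t)).
    apply is_derive_half_pos; auto. apply H1. lra.
  - intros t. destruct (H1 0 t (Rle_refl 0)) as [Hd _].
    apply (filterlim_comp _ _ _ (fun x => v x t) pi _ (locally (T := C_UniformSpace) (v 0 t))).
    + apply (filterdiff_continuous_aux (U := R_NormedModule) (V := C_R_NormedModule) (fun x => v x t)).
      * eexists; exact Hd.
      * intros P HP. now apply filter_le_within.
    + apply (linear_cont (U := C_R_NormedModule) (V := R_NormedModule) pi), pi_linear.
  - intros r t Hr. apply (is_derive_functional (fun y => v r y)). now apply H1.
  - intros r t Hr. destruct (H2 r t Hr) as [A1 [A2 [A3 A4]]].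
    split; [|split; [|split]].
    + now apply (is_derive_functional (fun x => vr x t)).
    + now apply (is_derive_functional (fun y => vr r y)).
    + now apply (is_derive_functional (fun x => vt x t)).
    + now apply (is_derive_functional (fun y => vt r y)).
  - do 5 (split; [now apply continuous_on_functional|]).
    split; [|split].
    + intros r t Hr. rewrite <- pi_operator, Hpde; auto.
    + intros t. now rewrite Hi.
    + intros t. now rewrite Hi'.
Qed.

End LinearFunctional.

Lemma KG_solution_unique u v : KG_solution u -> KG_solution v ->
  forall r t, 0 <= r -> u r t = v r t.
Proof.
  intros Hu Hv r t Hr. apply injective_projections.
  - assert (P : forall w, KG_solution w ->
      real_KG_solution (fun t => fst (expi t)) (fun r t => fst (w r t))).
    { apply (KG_solution_functional (fun c => fst c)).
      - apply (is_linear_fst (U := R_NormedModule) (V := R_NormedModule)).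
      - intros; simpl; ring.
      - reflexivity. }
    apply (real_KG_solution_unique _ _ _ (P u Hu) (P v Hv) r t Hr).
  - assert (P : forall w, KG_solution w ->
      real_KG_solution (fun t => snd (expi t)) (fun r t => snd (w r t))).
    { apply (KG_solution_functional (fun c => snd c)).
      - apply (is_linear_snd (U := R_NormedModule) (V := R_NormedModule)).
      - intros; simpl; ring.
      - reflexivity. }
    apply (real_KG_solution_unique _ _ _ (P u Hu) (P v Hv) r t Hr).
Qed.

Theorem theorem2 (N : nat) (HN : (1 <= N)%nat) :
  (forall n : nat, step_well_defined N (iterate N n)) /\
  (forall r : R, ex_pseries airy r) /\
  (forall rho : R, 0 < rho ->
     cvg_uniformly_on (fun r _ => - rho <= r <= rho) (iterate N) airy_wave) /\
  KG_solution airy_wave /\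
  (forall v : R -> R -> C, KG_solution v ->
     forall r t : R, 0 <= r -> v r t = airy_wave r t).
Proof.
  split; [|split; [|split; [|split]]].
  - intros n. apply (step_well_defined_wave _ (profile N n)).
    + apply iterate_profile.
    + apply smooth_profile.
  - intros r. apply ex_pseries_CV_infinite, CV_radius_airy.
  - intros rho Hrho. now apply iterate_cvg_uniformly.
  - exact KG_solution_airy_wave.
  - intros v Hv. apply KG_solution_unique; auto using KG_solution_airy_wave.
Qed.
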